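(* Let $p,q,n,m\in\mathbb{Z}_{\geq 0}$. Then the space $T_{p,q,n,m}=\mathrm{Sym}_\infty^{p}\times\mathrm{Alt}_\infty^{q}\times(\mathbb{C}^\infty)^n\times\mathbb{C}^m$ is $G_\infty$-Noetherian.
   Context: $\mathbb{C}^\infty$ denotes the space of all sequences $(c_i)_{i\in\mathbb{N}}$ of complex numbers, viewed as column vectors; $\mathbb{C}^\infty_{\mathrm{fin}}=\bigcup_{k}\mathbb{C}^k$ is the subspace of finitely supported sequences. $\mathrm{Mat}_\infty$ is the space of all matrices $(m_{i,j})_{i,j\in\mathbb{N}}$ with complex entries (identified with linear maps $\mathbb{C}^\infty_{\mathrm{fin}}\to\mathbb{C}^\infty$); $\mathrm{Sym}_\infty$ and $\mathrm{Alt}_\infty$ are its subspaces of symmetric and skew-symmetric matrices. All these spaces, and finite products of them with $\mathbb{C}^m$, are regarded as infinite-dimensional affine spaces with the Zariski topology: the coordinate ring is the polynomial ring in all (countably many) coordinates, so each polynomial involves only finitely many coordinates, and closed sets are common zero sets of sets of polynomials. $G_\infty=\bigcup_{k}\mathrm{GL}_k(\mathbb{C})$, where $\mathrm{GL}_k$ is embedded via $g\mapsto\mathrm{diag}(g,\mathrm{Id})$. $G_\infty$ acts on $\mathbb{C}^\infty$ by left multiplication, on $\mathrm{Mat}_\infty$ (hence on $\mathrm{Sym}_\infty$, $\mathrm{Alt}_\infty$) by $g\cdot M=gMg^T$, componentwise on products, and trivially on $\mathbb{C}^m$. For a group $G$ acting on a topological space $X$, $X$ is $G$-Noetherian if every strictly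 descending chain of $G$-stable closed subsets of $X$ has finite length. *)

(* Defs.v *)
From Stdlib Require Import Reals.
Open Scope R_scope.

Definition C : Type := (R * R)%type.
Definition C0 : C := (0, 0).
Definition C1 : C := (1, 0).
Definition Cadd (a b : C) : C := (fst a + fst b, snd a + snd b).
Definition Copp (a : C) : C := (- fst a, - snd a).
Definition Cmul (a b : C) : C :=
  (fst a * fst b - snd a * snd b, fst a * snd b + snd a * fst b).

Fixpoint Csum (N : nat) (f : nat -> C) : C :=
  match N with
  | O => C0
  | S N' => Cadd (Csum N' f) (f N')
  end.

Definition kron (i j : nat) : C := if Nat.eqb i j then C1 else C0.

(** * Coordinates of the ambient space
    Sym_oo^p x Alt_oo^q x (C^oo)^n x C^m is modelled inside the space of all
    functions Coord -> C:  cS k i j  = entry (i,j) of the k-th symmetric matrix,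
    cA k i j = entry (i,j) of the k-th skew-symmetric matrix, cV k i = i-th entry
    of the k-th vector, cC k = k-th coordinate of C^m.  Coordinates with an
    out-of-range block index k are required to be 0. *)
Inductive Coord : Type :=
| cS (k i j : nat)
| cA (k i j : nat)
| cV (k i : nat)
| cC (k : nat).

Definition Point : Type := Coord -> C.

Definition inT (p q n m : nat) (x : Point) : Prop :=
  (forall k i j, x (cS k i j) = x (cS k j i)) /\
  (forall k i j, x (cA k i j) = Copp (x (cA k j i))) /\
  (forall k i j, (p <= k)%nat -> x (cS k i j) = C0) /\
  (forall k i j, (q <= k)%nat -> x (cA k i j) = C0) /\
  (forall k i, (n <= k)%nat -> x (cV k i) = C0) /\
  (forall k, (m <= k)%nat -> x (cC k) = C0).

Inductive Poly : Type :=
| PConst (c : C)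
| PVar (v : Coord)
| PAdd (f g : Poly)
| PMul (f g : Poly).

Fixpoint peval (f : Poly) (x : Point) : C :=
  match f with
  | PConst c => c
  | PVar v => x v
  | PAdd f g => Cadd (peval f x) (peval g x)
  | PMul f g => Cmul (peval f x) (peval g x)
  end.

(** Zariski-closed subsets of T_{p,q,n,m}: common zero sets (in T) of sets of
    polynomials.  (T is a closed linear subspace of the ambient space, so this is
    the Zariski topology of T.) *)
Definition zclosed (p q n m : nat) (Z : Point -> Prop) : Prop :=
  exists P : Poly -> Prop,
    forall x, Z x <-> (inT p q n m x /\ forall f, P f -> peval f x = C0).

(** * The group G_oo = union of GL_k, GL_k embedded as g |-> diag(g, Id).
    [inGL K g]: the infinite matrix g equals diag(g0, Id) with g0 in GL_K. *)
Definition Mat : Type := nat -> nat -> C.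

Definition inGL (K : nat) (g : Mat) : Prop :=
  (forall i j, ((K <= i)%nat \/ (K <= j)%nat) -> g i j = kron i j) /\
  exists h : Mat,
    (forall i j, (i < K)%nat -> (j < K)%nat ->
       Csum K (fun l => Cmul (g i l) (h l j)) = kron i j) /\
    (forall i j, (i < K)%nat -> (j < K)%nat ->
       Csum K (fun l => Cmul (h i l) (g l j)) = kron i j).

(** Action of g (with witness K) : M |-> g M g^T, v |-> g v, trivial on C^m.
    Row i of g is supported in indices < K + i + 1, so the finite sums below
    are the full (infinite) sums. *)
Definition gact (K : nat) (g : Mat) (x : Point) : Point :=
  fun c =>
    match c with
    | cS k i j =>
        Csum (K + i + 1) (fun a =>
          Csum (K + j + 1) (fun b =>
            Cmul (g i a) (Cmul (x (cS k a b)) (g j b))))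
    | cA k i j =>
        Csum (K + i + 1) (fun a =>
          Csum (K + j + 1) (fun b =>
            Cmul (g i a) (Cmul (x (cA k a b)) (g j b))))
    | cV k i =>
        Csum (K + i + 1) (fun a => Cmul (g i a) (x (cV k a)))
    | cC k => x (cC k)
    end.

Definition Gstable (Z : Point -> Prop) : Prop :=
  forall K g, inGL K g -> forall x, Z x -> Z (gact K g x).

Definition strict_sub (B A : Point -> Prop) : Prop :=
  (forall x, B x -> A x) /\ exists x, A x /\ ~ B x.

Definition Ginf_Noetherian (p q n m : nat) : Prop :=
  ~ exists Z : nat -> (Point -> Prop),
      (forall t, zclosed p q n m (Z t) /\ Gstable (Z t)) /\
      (forall t, strict_sub (Z (S t)) (Z t)).

(* Main.v *)
From Stdlib Require Import Reals Lra.
From HB Require Import structures.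
From mathcomp Require Import all_boot all_algebra.
From mathcomp Require Import boolp.
Require Import Defs.
Set Implicit Arguments.
Unset Strict Implicit.
Unset Printing Implicit Defensive.
Import GRing.Theory.

(** Induction on the number of matrices, then on the number of vectors.  Given a
    descending chain Z_t of stable closed sets, let W_t be the closed set of scalar
    parameters c for which Z_t contains the whole fibre T x {c}.  By Hilbert's basis
    theorem W_t is eventually a constant W, and there is an N such that each c
    outside W is witnessed by an equation of Z_t, nonzero on the fibre, in
    coordinates of index less than N.

    If in a point x no nontrivial combination of the matrices vanishes on a
    subspace of codimension at most D = D(N), and the vectors are independent, then
    every N x N truncation of a point of T is a limit of truncations of points of
    the orbit of x: the tuples of Gram matrices of N vectors taken from a subspace
    of finite codimension add up along orthogonal families and are scaled by
    squares, so they fill the linear span of their values, and a linear functional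
    vanishing on all of them would give a degenerate combination.  Such an x
    therefore does not lie in Z_t over the complement of W.

    All other points lie in the images of finitely many equivariant polynomial maps
    from smaller spaces, which either express one matrix by the others, new scalars
    and a bounded number of new vectors, or one vector by the others and new
    scalars; there the induction hypothesis applies to the inverse image of the
    chain. *)

(** * The complex numbers as a field *)

Section ComplexField.
Local Open Scope R_scope.

Lemma CaddA : associative Cadd.
Proof. by move=> [a b] [c d] [e f]; rewrite /Cadd /=; congr pair; ring. Qed.
Lemma CaddC : commutative Cadd.
Proof. by move=> [a b] [c d]; rewrite /Cadd /=; congr pair; ring. Qed.
Lemma Cadd0 : left_id C0 Cadd.
Proof. by move=> [a b]; rewrite /Cadd /=; congr pair; ring. Qed.
Lemma CaddN : left_inverse C0 Copp Cadd.
Proof. by move=> [a b]; rewrite /Cadd /C0 /=; congr pair; ring. Qed.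
Lemma CmulA : associative Cmul.
Proof. by move=> [a b] [c d] [e f]; rewrite /Cmul /=; congr pair; ring. Qed.
Lemma CmulC : commutative Cmul.
Proof. by move=> [a b] [c d]; rewrite /Cmul /=; congr pair; ring. Qed.
Lemma Cmul1 : left_id C1 Cmul.
Proof. by move=> [a b]; rewrite /Cmul /=; congr pair; ring. Qed.
Lemma CmulDl : left_distributive Cmul Cadd.
Proof. by move=> [a b] [c d] [e f]; rewrite /Cmul /Cadd /=; congr pair; ring. Qed.

HB.instance Definition _ := gen_eqMixin C.
HB.instance Definition _ := gen_choiceMixin C.
HB.instance Definition _ := GRing.isZmodule.Build C CaddA CaddC Cadd0 CaddN.

Lemma C1_neq0 : C1 != 0%R :> C.
Proof. by apply/eqP => -[]; apply: R1_neq_R0. Qed.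

HB.instance Definition _ :=
  GRing.Zmodule_isComNzRing.Build C CmulA CmulC Cmul1 CmulDl C1_neq0.

Definition Cinv (a : C) : C :=
  let n := fst a * fst a + snd a * snd a in (fst a / n, - snd a / n).

Lemma CmulV (a : C) : a != 0%R -> Cmul (Cinv a) a = C1.
Proof.
case: a => a b /eqP n0; rewrite /Cmul /Cinv /C1 /=.
have ne : a * a + b * b <> 0.
  move=> E; have a0 : a = 0 by nra.
  have b0 : b = 0 by nra.
  by apply: n0; rewrite a0 b0.
by congr pair; field.
Qed.

Lemma Cinv0 : Cinv 0%R = 0%R.
Proof. by rewrite /Cinv /=; congr pair; rewrite /Rdiv ?Ropp_0 Rmult_0_l. Qed.

HB.instance Definition _ := GRing.ComNzRing_isField.Build C CmulV Cinv0.

(** With [r] the modulus, the half-sum and half-difference of [r] and the real part are the squares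
    of the real and imaginary parts of the root. *)
Lemma Csqrt_exists (a : C) : exists b : C, (b * b)%R = a.
Proof.
case: a => a b; pose r := sqrt (a * a + b * b).
have s0 : 0 <= a * a + b * b by nra.
have rr : r * r = a * a + b * b by apply: sqrt_sqrt.
have r0 : 0 <= r by apply: sqrt_pos.
have p1 : 0 <= (r + a) / 2 by nra.
have p2 : 0 <= (r - a) / 2 by nra.
pose x := sqrt ((r + a) / 2); pose y := sqrt ((r - a) / 2).
have xx : x * x = (r + a) / 2 by apply: sqrt_sqrt.
have yy : y * y = (r - a) / 2 by apply: sqrt_sqrt.
have x0 : 0 <= x by apply: sqrt_pos.
have y0 : 0 <= y by apply: sqrt_pos.
have xy0 : 0 <= x * y by nra.
have xy2 : (2 * (x * y)) * (2 * (x * y)) = b * b.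
  have -> : (2 * (x * y)) * (2 * (x * y)) = 4 * (x * x) * (y * y) by ring.
  rewrite xx yy; have -> : 4 * ((r + a) / 2) * ((r - a) / 2) = r * r - a * a by field.
  by rewrite rr; ring.
(* [2 * (x * y)] is the absolute value of [b]; the sign of [b] selects [x + iy] or [x - iy]. *)
have [b0|b0] := Rle_lt_dec 0 b.
  have xyb : 2 * (x * y) = b by apply: Rsqr_inj => //; lra.
  exists (x, y); change (Cmul (x, y) (x, y) = (a, b)).
  by rewrite /Cmul /=; congr pair; lra.
have xyb : 2 * (x * y) = - b by apply: Rsqr_inj; rewrite /Rsqr; lra.
exists (x, - y); change (Cmul (x, - y) (x, - y) = (a, b)).
by rewrite /Cmul /=; congr pair; lra.
Qed.

Lemma C_char0 n : (n.+1%:R)%R != 0%R :> C.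
Proof.
have E k : (k%:R)%R = (INR k, 0) :> C.
  elim: k => [//|k IH]; rewrite mulrSr IH S_INR.
  by congr pair; rewrite /=; ring.
rewrite E; apply/eqP => /(f_equal fst); exact: not_0_INR.
Qed.

End ComplexField.

From mathcomp Require Import zify ring.
Local Open Scope ring_scope.

(** * Chains of ideals and of zero sets *)

Lemma bounded_threshold (P : nat -> nat -> Prop) n :
  (forall d t u, (t <= u)%N -> P d t -> P d u) ->
  (forall d, exists t, P d t) -> exists T, forall d, (d < n)%N -> P d T.
Proof.
move=> Pmono Pex; elim: n => [|n [T HT]]; first by exists 0.
have [u Hu] := Pex n; exists (maxn T u) => d.
rewrite ltnS leq_eqVlt => /orP[/eqP-> | ltdn].
  exact: Pmono (leq_maxr _ _) Hu.
exact: Pmono (leq_maxl _ _) (HT _ ltdn).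
Qed.

Lemma finite_threshold (I : finType) (P : I -> nat -> Prop) :
  (forall i t u, (t <= u)%N -> P i t -> P i u) ->
  (forall i, exists t, P i t) -> exists T, forall i, P i T.
Proof.
move=> Pmono Pex.
have [|d|T HT] := @bounded_threshold
  (fun d t => forall i : I, nat_of_ord (enum_rank i) = d -> P i t) #|I|.
- by move=> d t u letu Ht i /Ht; apply: Pmono.
- case: (ltnP d #|I|) => ltd; last first.
    by exists 0 => i E; move: ltd; rewrite -E leqNgt ltn_ord.
  have [t Ht] := Pex (enum_val (Ordinal ltd)); exists t => i E.
  by rewrite -(enum_rankK i) (_ : enum_rank i = Ordinal ltd) //; apply: val_inj.
by exists T => i; apply: (HT (enum_rank i)).
Qed.

Section Hilbert.

Definition is_ideal (A : comNzRingType) (I : A -> Prop) :=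
  [/\ I 0, forall x y, I x -> I y -> I (x + y) & forall a x, I x -> I (a * x)].

Definition acc (A : comNzRingType) := forall I : nat -> A -> Prop,
  (forall t, is_ideal (I t)) -> (forall t x, I t x -> I t.+1 x) ->
  exists T, forall t x, (T <= t)%N -> I t x -> I T x.

Lemma ascending_le (T : Type) (I : nat -> T -> Prop) :
  (forall t x, I t x -> I t.+1 x) ->
  forall t u x, (t <= u)%N -> I t x -> I u x.
Proof.
move=> H t u x /subnK <-; elim: (u - t)%N => [|k IH] // /IH.
by rewrite addSn; apply: H.
Qed.

Lemma acc_field (F : fieldType) : acc F.
Proof.
move=> I idI asc.
have [[t [x [Ix xn0]]]|H] := EM (exists t x, I t x /\ x != 0).
  exists t => u y _ _; have [_ _ M] := idI t.
  by rewrite -(mulfVK xn0 y); apply: M.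
exists 0 => t x _ Itx; have [I0 _ _] := idI 0.
have [->//|xn0] := eqVneq x 0; case: H; by exists t, x.
Qed.

(** Hilbert's basis theorem. The ideals [L t d] of degree-[d] coefficients of members of [I t] of
    degree at most [d] grow with both [t] and [d]; once they are stationary, members of [I t] are
    reduced degree by degree by members of [I T]. *)
Lemma acc_poly (A : comNzRingType) : acc A -> acc {poly A}.
Proof.
move=> accA I idI asc.
pose L t d (a : A) := exists f, [/\ I t f, (size f <= d.+1)%N & f`_d = a].
have Lt t u d a : (t <= u)%N -> L t d a -> L u d a.
  by move=> tu [f [If sf fd]]; exists f; split=> //; apply: ascending_le tu If.
have Ld1 t d a : L t d a -> L t d.+1 a.
  move=> [f [If sf fd]]; exists ('X * f); split.
  - by have [_ _ IM] := idI t; apply: IM.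
  - rewrite mulrC; have [->|fn0] := eqVneq f 0; first by rewrite mul0r size_poly0.
    by rewrite size_mulX.
  - by rewrite mulrC coefMX.
have Ld t d e a : (d <= e)%N -> L t d a -> L t e a.
  by apply: (ascending_le (I := L t)); apply: Ld1.
have idL t d : is_ideal (L t d).
  have [I0 ID IM] := idI t; split.
  - by exists 0; rewrite size_poly0 coef0.
  - move=> x y [f [If sf <-]] [g [Ig sg <-]]; exists (f + g).
    rewrite coefD; split=> //; first exact: ID.
    by rewrite (leq_trans (size_polyD _ _)) // geq_max sf.
  - move=> a x [f [If sf <-]]; exists (a%:P * f).
    rewrite coefCM; split=> //; first exact: IM.
    by rewrite mul_polyC (leq_trans (size_scale_leq _ _)).
(* The diagonal chain settles all [d >= t0] at once; the finitely many smaller [d] are settled one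
   by one afterwards. *)
have [t0 Ht0] : exists T, forall t x, (T <= t)%N -> L t t x -> L T T x.
  apply: (accA (fun t => L t t)) => // t x /(Lt _ t.+1 _ _ (leqnSn t)).
  exact: Ld.
have [|d|T0 HT0] := @bounded_threshold
    (fun d T => forall t x, (T <= t)%N -> L t d x -> L T d x) t0.
- move=> d t u tu Ht s x us Lx; apply: (Lt _ _ _ _ tu).
  by apply: (Ht s) => //; apply: leq_trans tu us.
- by apply: (accA (fun t => L t d)) => // t x; apply: (Lt t t.+1).
pose T := maxn t0 T0.
have HT d t x : (T <= t)%N -> L t d x -> L T d x.
  rewrite geq_max => /andP[t0t T0t] Lx; have [dt0|t0d] := ltnP d t0.
    by apply: (Lt T0 _ _ _ (leq_maxr _ _)); apply: (HT0 d dt0 t).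
  apply: (Lt t0 _ _ _ (leq_maxl _ _)); apply: (Ld _ t0) => //; apply: (Ht0 (maxn t d)).
    by rewrite leq_max t0t.
  by apply: (Lt t _ _ _ (leq_maxl _ _)); apply: (Ld _ d _ _ (leq_maxr _ _)).
exists T => t f tT.
have [n] := ubnP (size f); elim: n f => // -[|n] IH f sf If.
  move: sf; rewrite ltnS leqn0 size_poly_eq0 => /eqP->.
  by have [] := idI T.
have [h [Ih sh hn]] : L T n f`_n by apply: (HT n t) => //; exists f.
have [_ D M] := idI T; have [_ Dt Mt] := idI t.
rewrite -(subrK h f); apply: D => //; apply: IH.
  rewrite ltnS; apply/leq_sizeP => j; rewrite leq_eqVlt => /orP[/eqP<-|nj].
    by rewrite coefB hn subrr.
  have z (g : {poly A}) : (size g <= n.+1)%N -> g`_j = 0.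
    by move=> sg; apply: nth_default; apply: leq_trans sg nj.
  by rewrite coefB !z // subrr.
apply: Dt => //; rewrite -mulN1r; apply: Mt; exact: ascending_le tT Ih.
Qed.

End Hilbert.

(** * Polynomial functions and finite-dimensional affine spaces *)

Section Polyfun.
Variable F : fieldType.

(** Polynomials are kept as functions on an arbitrary set, so that pulling back along a map is plain
    composition. *)
Inductive polyfun (X : Type) (V : (X -> F) -> Prop) : (X -> F) -> Prop :=
| Pf_cst c : polyfun V (fun=> c)
| Pf_gen g : V g -> polyfun V g
| Pf_add f g : polyfun V f -> polyfun V g -> polyfun V (fun x => f x + g x)
| Pf_mul f g : polyfun V f -> polyfun V g -> polyfun V (fun x => f x * g x).

Lemma polyfun_sum X (V : (X -> F) -> Prop) (T : Type) (r : seq T) (P : pred T) f :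
  (forall i, polyfun V (f i)) ->
  polyfun V (fun x => \sum_(i <- r | P i) f i x).
Proof.
move=> H; elim: r => [|i r IH].
  rewrite (_ : (fun _ => _) = fun=> 0); first exact: Pf_cst.
  by apply/funext => x; rewrite big_nil.
rewrite (_ : (fun _ => _) = (fun x => (if P i then f i x else 0) +
   \sum_(j <- r | P j) f j x)).
  by apply: Pf_add => //; case: (P i) => //; apply: Pf_cst.
by apply/funext => x; rewrite big_cons; case: (P i); rewrite ?add0r.
Qed.

Lemma polyfun_comp X Y (V : (X -> F) -> Prop) (W : (Y -> F) -> Prop)
    (phi : Y -> X) f :
  (forall g, V g -> polyfun W (g \o phi)) ->
  polyfun V f -> polyfun W (f \o phi).
Proof.
move=> H; elim=> [c|g|f1 g1 _ H1 _ H2|f1 g1 _ H1 _ H2].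
- exact: (Pf_cst _ c).
- exact: H.
- exact: (Pf_add H1 H2).
- exact: (Pf_mul H1 H2).
Qed.

Lemma polyfun_sub X (V W : (X -> F) -> Prop) f :
  (forall g, V g -> W g) -> polyfun V f -> polyfun W f.
Proof. by move=> H; apply: (polyfun_comp (phi := id)) => g /H; apply: Pf_gen. Qed.

Lemma polyfun_eq X (V : (X -> F) -> Prop) f x y :
  (forall g, V g -> g x = g y) -> polyfun V f -> f x = f y.
Proof.
by move=> H; elim=> [//|g /H|f1 g1 _ H1 _ H2|f1 g1 _ H1 _ H2] //; congr (_ _ _).
Qed.

Lemma polyfun_directed X (V : nat -> (X -> F) -> Prop) f :
  (forall m n g, (m <= n)%N -> V m g -> V n g) ->
  polyfun (fun g => exists n, V n g) f -> exists n, polyfun (V n) f.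
Proof.
move=> mono; elim=> [c|g [n Vg]|f1 g1 _ [m H1] _ [n H2]|f1 g1 _ [m H1] _ [n H2]].
- by exists 0; apply: Pf_cst.
- by exists n; apply: Pf_gen.
- exists (maxn m n); apply: Pf_add.
    by apply: polyfun_sub H1 => g; apply: mono (leq_maxl _ _).
  by apply: polyfun_sub H2 => g; apply: mono (leq_maxr _ _).
- exists (maxn m n); apply: Pf_mul.
    by apply: polyfun_sub H1 => g; apply: mono (leq_maxl _ _).
  by apply: polyfun_sub H2 => g; apply: mono (leq_maxr _ _).
Qed.

Lemma polyfun_line (h : F -> F) :
  polyfun (fun g => g = id) h -> exists p : {poly F}, forall s, h s = p.[s].
Proof.
elim=> [c|g ->|f1 g1 _ [p H1] _ [q H2]|f1 g1 _ [p H1] _ [q H2]].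
- by exists c%:P => s; rewrite hornerC.
- by exists 'X => s; rewrite hornerX.
- by exists (p + q) => s; rewrite hornerD H1 H2.
- by exists (p * q) => s; rewrite hornerM H1 H2.
Qed.

(** A nonzero polynomial has finitely many roots, while [1, 2, 3, ...] are distinct in
    characteristic zero. This keeps limits at [s = 0] of polynomial curves inside closed sets. *)
Lemma polyfun_line_eq0 (h : F -> F) :
  (forall n, n.+1%:R != 0 :> F) ->
  polyfun (fun g => g = id) h -> (forall s, s != 0 -> h s = 0) -> h 0 = 0.
Proof.
move=> char0 /polyfun_line[p Hp] h0; rewrite Hp.
suff -> : p = 0 by rewrite horner0.
apply/eqP; apply: contraT => pn0.
pose rs := [seq k.+1%:R : F | k <- iota 0 (size p)].
have : (size rs < size p)%N.
  apply: max_poly_roots => //.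
    by apply/allP => _ /mapP[k _ ->]; apply/rootP; rewrite -Hp h0.
  have inj a b : (a <= b)%N -> a.+1%:R = b.+1%:R :> F -> a = b.
    rewrite leq_eqVlt => /orP[/eqP//|ltab] E.
    have := char0 (b - a).-1; rewrite prednK ?subn_gt0 //.
    by rewrite -subSS natrB 1?ltnW // E subrr eqxx.
  rewrite map_inj_uniq ?iota_uniq // => a b E.
  by case/orP: (leq_total a b) => le; [apply: inj|apply/esym/inj].
by rewrite size_map size_iota ltnn.
Qed.

(** [A] is a polynomial ring over [F] with one variable per element of [K], adjoined one at a time;
    [ev x] substitutes [g k x]. *)
Lemma generated_by_noetherian (X : Type) (K : finType) (g : K -> X -> F) :
  exists (A : comNzRingType) (ev : X -> {rmorphism A -> F}),
    [/\ acc A, forall c, exists a, forall x, ev x a = c &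
        forall k, exists a, forall x, ev x a = g k x].
Proof.
have main (s : seq K) : exists (A : comNzRingType) (ev : X -> {rmorphism A -> F}),
    [/\ acc A, forall c, exists a, forall x, ev x a = c &
        forall k, k \in s -> exists a, forall x, ev x a = g k x].
  elim: s => [|k s [A [ev [accA cA gA]]]].
    exists F, (fun=> idfun); split=> //; first exact: acc_field.
    by move=> c; exists c.
  have cfu x : commr_rmorph (ev x) (g k x) by move=> a; apply: mulrC.
  exists {poly A}, (fun x => horner_morph (cfu x)); split.
  - exact: acc_poly.
  - move=> c; have [a Ha] := cA c; exists a%:P => x /=.
    by rewrite horner_morphC Ha.
  - move=> l; rewrite inE => /orP[/eqP->|/gA[a Ha]].
      by exists 'X => x /=; rewrite horner_morphX.
    by exists a%:P => x /=; rewrite horner_morphC Ha.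
have [A [ev [accA cA gA]]] := main (enum K).
by exists A, ev; split=> // k; apply: gA; rewrite mem_enum.
Qed.

(** Descending zero sets have ascending vanishing ideals in [A], and a zero set is recovered from
    its ideal. *)
Lemma affine_noetherian (X : Type) (K : finType) (g : K -> X -> F)
    (Z : nat -> X -> Prop) :
  (forall t, exists P : (X -> F) -> Prop,
     (forall f, P f -> polyfun (fun h => exists k, h = g k) f) /\
     (forall x, Z t x <-> forall f, P f -> f x = 0)) ->
  (forall t x, Z t.+1 x -> Z t x) ->
  exists T, forall t x, (T <= t)%N -> Z T x -> Z t x.
Proof.
move=> clZ desc.
have [A [ev [accA cA gA]]] := generated_by_noetherian g.
have lift f : polyfun (fun h => exists k, h = g k) f -> exists a, forall x, ev x a = f x.
  elim=> [c|h [k ->]|f1 g1 _ [a Ha] _ [b Hb]|f1 g1 _ [a Ha] _ [b Hb]] //.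
    by exists (a + b) => x; rewrite rmorphD Ha Hb.
  by exists (a * b) => x; rewrite rmorphM Ha Hb.
pose I t a := forall x, Z t x -> ev x a = 0.
have [t|t a Ia x /desc|T HT] := accA I; [|exact: Ia|].
  split=> [x _|a b Ia Ib x Zx|a b Ib x Zx]; first exact: rmorph0.
    by rewrite rmorphD Ia // Ib // addr0.
  by rewrite rmorphM Ib // mulr0.
exists T => t x Tt ZT; have [P [polP HP]] := clZ t.
apply/HP => f Pf; have [a Ha] := lift _ (polP _ Pf); rewrite -Ha.
by apply: (HT t) ZT => // y /HP Zy; rewrite Ha; apply: Zy.
Qed.

End Polyfun.

(** * Bilinear forms on finitely supported sequences *)

(* Finitely supported sequences are represented by polynomials, so that a
   sequence [u] is a linear functional and an infinite matrix a bilinear form. *)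
HB.lock Definition lf (F : fieldType) (u : nat -> F) (p : {poly F}) : F :=
  \sum_(a < size p) p`_a * u a.

Section Forms.
Variable F : fieldType.
Implicit Types (u : nat -> F) (M : nat -> nat -> F) (p q : {poly F}).

Definition form M p q := lf (fun a => lf (M a) q) p.

Lemma lfE u p n : (size p <= n)%N -> lf u p = \sum_(a < n) p`_a * u a.
Proof.
move=> le; rewrite lf.unlock (big_ord_widen n (fun a => p`_a * u a)) // big_mkcond /=.
by apply: eq_bigr => a _; case: ltnP => // /(nth_default 0) ->; rewrite mul0r.
Qed.

Lemma lf_is_linear u : scalar (lf u).
Proof.
move=> c p q; pose n := maxn (size p) (size q).
have le : (size (c *: p + q)%R <= n)%N.
  rewrite (leq_trans (size_polyD _ _)) // geq_max leq_maxr andbT.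
  by rewrite (leq_trans (size_scale_leq _ _)) // leq_maxl.
rewrite (lfE u le) (lfE u (leq_maxl _ _ : size p <= n)%N).
rewrite (lfE u (leq_maxr _ _ : size q <= n)%N).
rewrite mulr_sumr -big_split; apply: eq_bigr => a _ /=.
by rewrite coefD coefZ; ring.
Qed.
HB.instance Definition _ u :=
  GRing.isLinear.Build F {poly F} F *%R (lf u) (lf_is_linear u).

Lemma lfXn u a : lf u 'X^a = u a.
Proof.
rewrite lf.unlock size_polyXn big_ord_recr /= coefXn eqxx mul1r.
rewrite big1 ?add0r // => i _; rewrite coefXn.
by rewrite (ltn_eqF (ltn_ord i)) mul0r.
Qed.

Lemma lf_comb (T : Type) (r : seq T) (P : pred T) (c : T -> F) (u : T -> nat -> F) p :
  lf (fun a => \sum_(i <- r | P i) c i * u i a) p = \sum_(i <- r | P i) c i * lf (u i) p.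
Proof.
rewrite lf.unlock.
under eq_bigr do rewrite mulr_sumr.
rewrite exchange_big; apply: eq_bigr => i _; rewrite mulr_sumr.
by apply: eq_bigr => a _; ring.
Qed.

Lemma lfD u v p : lf (fun a => u a + v a) p = lf u p + lf v p.
Proof. by rewrite lf.unlock -big_split; apply: eq_bigr => a _; rewrite mulrDr. Qed.

Lemma lfZ c u p : lf (fun a => c * u a) p = c * lf u p.
Proof. by rewrite lf.unlock mulr_sumr; apply: eq_bigr => a _; rewrite mulrCA. Qed.

Lemma lf0 p : lf (fun=> 0) p = 0.
Proof. by rewrite lf.unlock big1 // => a _; rewrite mulr0. Qed.

Lemma form_tr M p q : form M p q = form (fun a b => M b a) q p.
Proof.
rewrite /form lf.unlock.
under eq_bigr do rewrite mulr_sumr.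
rewrite exchange_big; apply: eq_bigr => b _; rewrite mulr_sumr.
by apply: eq_bigr => a _; ring.
Qed.

(** The sequence representing the functional [form M p]; orthogonality to [p] becomes one linear
    equation. *)
Definition row_of M p : nat -> F := fun b => lf (M^~ b) p.

Lemma formE M p q : form M p q = lf (row_of M p) q.
Proof. exact: form_tr. Qed.

Lemma formXn M a b : form M 'X^a 'X^b = M a b.
Proof. by rewrite /form !lfXn. Qed.

Lemma form_rank1 u v p q : form (fun a b => u a * v b) p q = lf u p * lf v q.
Proof.
rewrite /form lf.unlock mulr_suml; apply: eq_bigr => a _; rewrite -mulrA; congr (_ * _).
by rewrite mulr_sumr; apply: eq_bigr => b _; rewrite mulrCA.
Qed.

Lemma form_comb (T : Type) (r : seq T) (P : pred T) (c : T -> F)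
    (M : T -> nat -> nat -> F) p q :
  form (fun a b => \sum_(i <- r | P i) c i * M i a b) p q =
  \sum_(i <- r | P i) c i * form (M i) p q.
Proof.
rewrite formE /row_of; under eq_fun do rewrite lf_comb.
by rewrite lf_comb; under eq_bigr do rewrite -formE.
Qed.

Lemma formD M M' p q :
  form (fun a b => M a b + M' a b) p q = form M p q + form M' p q.
Proof. by rewrite /form; under eq_fun do rewrite lfD; rewrite lfD. Qed.

Lemma formZ c M p q : form (fun a b => c * M a b) p q = c * form M p q.
Proof. by rewrite /form; under eq_fun do rewrite lfZ; rewrite lfZ. Qed.

Lemma form_sum_rank1 (E : finType) (u v : E -> nat -> F) p q :
  form (fun a b => \sum_e u e a * v e b) p q = \sum_e lf (u e) p * lf (v e) q.
Proof.
under [in LHS]eq_fun do under eq_fun do under eq_bigr do rewrite -[X in X * _]mul1r -mulrA.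
by rewrite form_comb; apply: eq_bigr => e _; rewrite mul1r form_rank1.
Qed.

Lemma form_lin2 M p q p' q' (s : F) : form M (p + s *: p') (q + s *: q') =
  form M p q + s * (form M p q' + form M p' q) + s * s * form M p' q'.
Proof.
rewrite formE linearD linearZ /= -!formE ![form _ (_ + _) _]form_tr !formE.
by rewrite !linearD !linearZ /= -!formE -!(form_tr M); ring.
Qed.

Lemma form_sym (s : F) M p q :
  (forall a b, M a b = s * M b a) -> form M p q = s * form M q p.
Proof.
move=> H; rewrite form_tr -formZ; congr (form _ _ _).
by apply/funext => a; apply/funext => b; rewrite H.
Qed.

(** Subspaces of finite codimension are given by equations; these may be dependent, so their number
    only bounds the codimension. *)
Definition ann (E : finType) (phi : E -> nat -> F) p := forall e, lf (phi e) p = 0.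

Lemma ann_lin (E : finType) (phi : E -> nat -> F) c p q :
  ann phi p -> ann phi q -> ann phi (p + c *: q).
Proof. by move=> Hp Hq e; rewrite linearD linearZ /= Hp Hq mulr0 addr0. Qed.

Definition sum_fam (E1 E2 : Type) (T : Type) (f : E1 -> T) (g : E2 -> T) (e : E1 + E2) :=
  match e with inl x => f x | inr y => g y end.

Lemma ann_sum (E1 E2 : finType) (f : E1 -> nat -> F) (g : E2 -> nat -> F) p :
  ann (sum_fam f g) p <-> ann f p /\ ann g p.
Proof.
split=> [H|[Hf Hg] [e|e]]; [|exact: Hf|exact: Hg].
by split=> e; [apply: (H (inl e)) | apply: (H (inr e))].
Qed.

(** A projection onto the common kernel differs from the identity by a map of finite rank. It is
    built by adding one equation at a time. *)
Lemma kernel_projection (E : finType) (phi : E -> nat -> F) :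
  exists d : E -> {poly F}, forall p, ann phi (p - \sum_e lf (phi e) p *: d e).
Proof.
suff main (s : seq E) : uniq s -> exists d : E -> {poly F}, forall p l, l \in s ->
    lf (phi l) (p - \sum_(e <- s) lf (phi e) p *: d e) = 0.
  have [d Hd] := main _ (index_enum_uniq E).
  by exists d => p e; apply: Hd; rewrite mem_index_enum.
elim: s => [|x s IH]; first by exists (fun=> 0).
rewrite cons_uniq => /andP[xs /IH[d Hd]].
pose P p := p - \sum_(e <- s) lf (phi e) p *: d e.
(* If [phi x] is nonzero somewhere on the image of [P], a vector there is scaled to value 1;
   otherwise [w = 0] works. *)
have [w [wx ws]] : exists w, (forall p, lf (phi x) (P p) = lf (phi x) (P p) * lf (phi x) w)
    /\ (forall l, l \in s -> lf (phi l) w = 0).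
  have [[z zn0]|H] := EM (exists z, lf (phi x) (P z) != 0).
    exists ((lf (phi x) (P z))^-1 *: P z); split=> [p|l ls]; rewrite linearZ /=.
      by rewrite mulVf // mulr1.
    by rewrite (Hd z l ls) mulr0.
  exists 0; split=> [p|l _]; last by rewrite linear0.
  rewrite (linear0 (lf (phi x))) mulr0; apply/eqP; apply: contraT => n0; case: H; by exists p.
exists (fun e => if e == x then w else d e - lf (phi x) (d e) *: w) => p l.
have -> : p - \sum_(e <- x :: s) lf (phi e) p *: (if e == x then w else d e - lf (phi x) (d e) *: w)
    = P p - lf (phi x) (P p) *: w.
  have -> : lf (phi x) (P p) = lf (phi x) p - \sum_(e <- s) lf (phi e) p * lf (phi x) (d e).
    rewrite linearB linear_sum; congr (_ - _).
    by apply: eq_bigr => e _; rewrite linearZ.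
  rewrite big_cons eqxx scalerBl scaler_suml (eq_big_seq (fun e =>
    lf (phi e) p *: d e - (lf (phi e) p * lf (phi x) (d e)) *: w)); last first.
    by move=> e es; rewrite (negbTE (memPn xs e es)) scalerBr scalerA.
  by rewrite sumrB /P !opprD !opprK !addrA; congr (_ + _); rewrite addrAC.
rewrite inE linearB linearZ /= => /orP[/eqP->|ls]; last by rewrite ws // mulr0 subr0 Hd.
by rewrite -wx subrr.
Qed.

(** The projection gives [v_l = sum_j v_l(d_j) v_j]. If the matrix of the [v_l(d_j)] is the
    identity, [d] is a dual family; otherwise a row that differs from the identity yields a
    nontrivial relation. *)
Lemma dual_or_dependent (J : finType) (v : J -> nat -> F) :
  (forall w : J -> F, exists p, forall j, lf (v j) p = w j) \/
  (exists (k : J) (c : J -> F), forall a, v k a = \sum_(j | j != k) c j * v j a).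
Proof.
have [d Hd] := kernel_projection v.
have rel l p : lf (v l) p = \sum_j lf (v j) p * lf (v l) (d j).
  apply/eqP; rewrite -subr_eq0; apply/eqP; rewrite -[RHS](Hd p l).
  rewrite linearB linear_sum; congr (_ - _).
  by apply: eq_bigr => j _; rewrite linearZ.
have [H|/existsNP[l /existsNP[k /eqP ne]]] := EM (forall l j, lf (v l) (d j) = (l == j)%:R).
  left=> w; exists (\sum_j w j *: d j) => l; rewrite linear_sum (bigD1 l) //=.
  rewrite linearZ /= H eqxx mulr1 big1 ?addr0 // => j jl.
  by rewrite linearZ /= H eq_sym (negbTE jl) mulr0.
right; exists k.
pose g j := (l == j)%:R - lf (v l) (d j).
have gk : g k != 0 by rewrite subr_eq0 eq_sym.
have g0 p : \sum_j lf (v j) p * g j = 0.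
  under eq_bigr do rewrite mulrBr.
  rewrite sumrB -rel (bigD1 l) //= eqxx mulr1 big1 ?addr0 ?subrr // => j jl.
  by rewrite eq_sym (negbTE jl) mulr0.
exists (fun j => - (g j / g k)) => a.
have := g0 'X^a; rewrite (bigD1 k) //= lfXn => /eqP; rewrite addr_eq0 => /eqP E.
apply: (mulIf gk); rewrite E mulr_suml -sumrN; apply: eq_bigr => j _.
by rewrite lfXn; field.
Qed.

(** Evaluating [M] on the projections of two unit vectors gives 0; expanded, this writes [M a b] in
    terms that each contain some [phi e a] or [phi e b]. *)
Lemma vanishing_form_decomposition (E : finType) (phi : E -> nat -> F) (s : F) M :
  2%:R != 0 :> F ->
  s * s = 1 -> (forall a b, M a b = s * M b a) ->
  (forall p q, ann phi p -> ann phi q -> form M p q = 0) ->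
  exists f : E -> nat -> F, forall a b,
    M a b = \sum_e phi e a * f e b + s * \sum_e f e a * phi e b.
Proof.
move=> n2 ss sym van; have [d Hd] := kernel_projection phi.
pose c e e' := form M (d e) (d e').
pose g e b := lf (M^~ b) (d e).
(* The double sum over [c] contains [phi] on both sides; half of it goes to each sum of the
   conclusion. *)
exists (fun e b => g e b - 2^-1 * \sum_e' phi e' b * c e e') => a b.
have := van _ _ (Hd 'X^a) (Hd 'X^b).
under eq_bigr do rewrite lfXn.
under [in X in form _ _ X]eq_bigr do rewrite lfXn.
set A := \sum_e _; set B := \sum_e _.
have cs e e' : c e e' = s * c e' e by apply: form_sym.
have E1 : form M A 'X^b = \sum_e phi e a * g e b.
  rewrite /form linear_sum; apply: eq_bigr => e _; rewrite linearZ /=; congr (_ * _).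
  by rewrite /g; congr (lf _ _); apply/funext => x; rewrite lfXn.
have E2 : form M 'X^a B = s * \sum_e phi e b * g e a.
  rewrite (form_sym _ _ sym); congr (_ * _).
  rewrite /form linear_sum; apply: eq_bigr => e _; rewrite linearZ /=; congr (_ * _).
  by rewrite /g; congr (lf _ _); apply/funext => x; rewrite lfXn.
have E3 : form M A B = \sum_e \sum_e' phi e a * phi e' b * c e e'.
  rewrite /form linear_sum; apply: eq_bigr => e _; rewrite linearZ /=.
  rewrite -/(form M (d e) B) formE linear_sum mulr_sumr; apply: eq_bigr => e' _.
  by rewrite linearZ /= -formE mulrA.
rewrite formE linearB /= -!formE ![form M (_ - _) _]/form !linearB /= -!/(form M _ _).
rewrite formXn E1 E2 E3 => /eqP; rewrite subr_eq0 => /eqP /eqP.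
rewrite subr_eq => /eqP ->.
under [in RHS]eq_bigr do rewrite mulrBr.
rewrite sumrB.
under [X in _ + s * X]eq_bigr do rewrite mulrBl.
rewrite sumrB mulrBr.
have -> : \sum_e phi e a * (2^-1 * \sum_e' phi e' b * c e e') =
   2^-1 * \sum_e \sum_e' phi e a * phi e' b * c e e'.
  rewrite mulr_sumr; apply: eq_bigr => e _; rewrite mulrCA; congr (_ * _).
  by rewrite mulr_sumr; apply: eq_bigr => e' _; rewrite mulrA.
have -> : s * (\sum_e 2^-1 * (\sum_e' phi e' a * c e e') * phi e b) =
   2^-1 * \sum_e \sum_e' phi e a * phi e' b * c e e'.
  rewrite [X in _ = _ * X]exchange_big /= !mulr_sumr; apply: eq_bigr => e _.
  rewrite mulr_sumr mulr_suml !mulr_sumr; apply: eq_bigr => e' _.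
  by rewrite (cs e' e); ring.
have -> : \sum_e g e a * phi e b = \sum_e phi e b * g e a.
  by apply: eq_bigr => e _; rewrite mulrC.
set X := \sum_e \sum_e' _; rewrite -{1}[X]mul1r -{1}(mulfV n2); ring.
Qed.

End Forms.

(** * Prescribing Gram matrices under nondegenerate forms *)

Section Nondegenerate.
Variable F : fieldType.
Hypothesis sqrtF : forall a : F, exists b, b * b = a.
Hypothesis n2 : 2%:R != 0 :> F.
Variables (I : finType) (eps : I -> bool) (B : I -> nat -> nat -> F).
Hypothesis symB : forall i a b, B i a b = (-1) ^+ eps i * B i b a.

(** The combinations mix symmetric and skew forms, and the functionals may be dependent, so every
    codimension up to [D] is covered. *)
Definition nondegenerate D := forall (phi : 'I_D -> nat -> F) (c : I -> F),
  (forall p q, ann phi p -> ann phi q -> \sum_i c i * form (B i) p q = 0) ->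
  forall i, c i = 0.

Let form_symB i p q : form (B i) p q = (-1) ^+ eps i * form (B i) q p.
Proof. exact: form_sym. Qed.

Let card_orth N : #|{: I * 'I_N}| = (#|I| * N)%N.
Proof. by rewrite card_prod card_ord. Qed.

Lemma nondegenerate_family D (E : finType) (phi : E -> nat -> F) (c : I -> F) :
  nondegenerate D -> (#|E| <= D)%N ->
  (forall p q, ann phi p -> ann phi q -> \sum_i c i * form (B i) p q = 0) ->
  forall i, c i = 0.
Proof.
move=> ND leED H.
(* The family is padded to length [D] by zero functionals. *)
pose psi (l : 'I_D) := if insub (l : nat) is Some k then phi (@enum_val _ E k) else fun=> 0.
apply: (ND psi) => p q.
have sub r : ann psi r -> ann phi r.
  move=> Hr e; have := Hr (widen_ord leED (enum_rank e)).
  rewrite /psi; case: insubP => [k _ kE|]; last by rewrite /= ltn_ord.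
  by rewrite (_ : k = enum_rank e) ?enum_rankK //; apply: val_inj.
by move=> /sub Hp /sub Hq; apply: H.
Qed.

Section Values.
Variables N D : nat.
Hypothesis ND : nondegenerate D.

Let T : finType := (I * 'I_N * 'I_N)%type.

Let sum3 (G : T -> F) : \sum_x G x = \sum_i \sum_a \sum_b G (i, a, b).
Proof.
rewrite (pair_bigA _ (fun i a => \sum_b G (i, a, b))) /=.
rewrite (pair_bigA _ (fun (y : I * 'I_N) b => G (y.1, y.2, b))) /=.
by apply: eq_bigr => -[[i a] b].
Qed.

Let vec (g : T -> F) : 'rV[F]_#|T| := \row_k g (enum_val k).

Let vec_mul g (c : 'cV_#|T|) :
  vec g *m c = (\sum_x g x * c (enum_rank x) 0)%:M.
Proof.
apply/matrixP => i j; rewrite !ord1 !mxE eqxx mulr1n.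
rewrite (reindex (@enum_rank T)) /=; last by apply: onW_bij; apply: enum_rank_bij.
by apply: eq_bigr => x _; rewrite mxE enum_rankK.
Qed.

(** The Gram matrices of the tuple [xi] under all forms, read as one vector of a finite-dimensional
    space. *)
Definition values (xi : 'I_N -> {poly F}) (x : I * 'I_N * 'I_N) :=
  form (B x.1.1) (xi x.1.2) (xi x.2).

(** Polarisation: comparing [xi], [eta] and their sum leaves the cross terms. With [xi] concentrated
    at [a] and [eta] at [b], these are a combination of the forms vanishing on [ann phi], so its
    coefficients are zero. *)
Let annihilator_antisym (E : finType) (phi : E -> nat -> F) (c : T -> F) :
  (#|E| <= D)%N ->
  (forall xi, (forall a, ann phi (xi a)) -> \sum_x values xi x * c x = 0) ->
  forall i a b, c (i, a, b) = - ((-1) ^+ eps i * c (i, b, a)).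
Proof.
move=> leED H i a b; apply/eqP; rewrite -addr_eq0; apply/eqP.
apply: (nondegenerate_family (phi := phi) (c := fun i =>
  c (i, a, b) + (-1) ^+ eps i * c (i, b, a))) ND leED _ i => p q Hp Hq.
pose xi x := if x == a then p else 0.
pose eta x := if x == b then q else 0.
have ann0 : ann phi 0 by move=> e; rewrite linear0.
have Hxi x : ann phi (xi x) by rewrite /xi; case: ifP.
have Heta x : ann phi (eta x) by rewrite /eta; case: ifP.
have /H : forall x, ann phi (xi x + 1 *: eta x) by move=> x; apply: ann_lin.
rewrite /values; under eq_bigr do rewrite form_lin2 !mul1r !mulrDl.
rewrite !big_split /= (H _ Hxi) (H _ Heta) add0r addr0 !sum3 => E0.
have f0l j r : form (B j) 0 r = 0 by rewrite form_tr formE linear0.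
have f0r j r : form (B j) r 0 = 0 by rewrite formE linear0.
rewrite -[RHS]E0 -big_split /=; apply: eq_bigr => j _.
have -> : \sum_x \sum_y form (B j) (xi x) (eta y) * c (j, x, y) =
    form (B j) p q * c (j, a, b).
  rewrite (bigD1 a) //= [X in _ + X]big1 ?addr0 => [|x /negbTE xa]; last first.
    by apply: big1 => y _; rewrite /xi xa f0l mul0r.
  rewrite (bigD1 b) //= big1 ?addr0 => [|y /negbTE yb]; last first.
    by rewrite /eta yb f0r mul0r.
  by rewrite /xi /eta !eqxx.
have -> : \sum_x \sum_y form (B j) (eta x) (xi y) * c (j, x, y) =
    form (B j) q p * c (j, b, a).
  rewrite (bigD1 b) //= [X in _ + X]big1 ?addr0 => [|x /negbTE xb]; last first.
    by apply: big1 => y _; rewrite /eta xb f0l mul0r.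
  rewrite (bigD1 a) //= big1 ?addr0 => [|y /negbTE ya]; last first.
    by rewrite /xi ya f0r mul0r.
  by rewrite /xi /eta !eqxx.
by rewrite (form_symB j q p); ring.
Qed.

(** Under the swap of [a] and [b] twisted by the sign, [t] is symmetric and [c] antisymmetric, so
    the sum equals its own negative. *)
Let target_annihilated (E : finType) (phi : E -> nat -> F) (c : T -> F) (t : T -> F) :
  (#|E| <= D)%N ->
  (forall xi, (forall a, ann phi (xi a)) -> \sum_x values xi x * c x = 0) ->
  (forall i a b, t (i, a, b) = (-1) ^+ eps i * t (i, b, a)) ->
  \sum_x t x * c x = 0.
Proof.
move=> leED /annihilator_antisym-/(_ leED) Hc Ht.
have E1 : \sum_x t x * c x = - \sum_x t x * c x.
  rewrite [in LHS]sum3 [in RHS]sum3 -sumrN; apply: eq_bigr => i _.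
  rewrite [LHS]exchange_big /= -sumrN; apply: eq_bigr => a _.
  rewrite -sumrN; apply: eq_bigr => b _.
  rewrite (Ht i b a) (Hc i b a) mulrN; congr (- _).
  by rewrite mulrACA -expr2 sqrr_sign mul1r.
apply: (mulfI n2); rewrite mulr0 mulr_natl mulr2n; by rewrite {1}E1 addNr.
Qed.

(* Values of families orthogonal to each other add up, and values are scaled
   by squares; hence a linear space of values can be enlarged until it
   contains the target. *)
Let enlarge (E : finType) (phi : E -> nat -> F) (t : T -> F) k :
  (forall i a b, t (i, a, b) = (-1) ^+ eps i * t (i, b, a)) ->
  (#|E| + k * (#|I| * N) <= D)%N ->
  exists (E' : finType) (psi : E' -> nat -> F) (M : 'M[F]_#|T|),
  [/\ (#|E'| <= k * (#|I| * N))%N, (k <= \rank M)%N \/ (vec t <= M)%MS &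
    forall u : 'rV_#|T|, (u <= M)%MS -> exists xi,
      [/\ forall a, ann phi (xi a), vec (values xi) = u &
        forall i a p, ann psi p -> form (B i) (xi a) p = 0]].
Proof.
move=> symt; elim: k => [|k IH] leD.
  exists 'I_0, (fun=> fun=> 0), 0; split=> [|| u /submx0null->].
  - by rewrite card_ord.
  - by left.
  exists (fun=> 0); split=> [a e||i a p _].
  - by rewrite linear0.
  - by apply/rowP => j; rewrite !mxE /values formE linear0.
  - by rewrite form_tr formE linear0.
have [|E' [psi [M [leE' HM HU]]]] := IH.
  by apply: leq_trans leD; rewrite leq_add2l leq_mul2r leqnSn orbT.
have [tM|tM] := boolP (vec t <= M)%MS.
  exists E', psi, M; split=> //; last by right.
  by apply: leq_trans leE' _; rewrite leq_mul2r leqnSn orbT.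
have {HM} rkM : (k <= \rank M)%N by case: HM => // h; rewrite h in tM.
(* A column of the cokernel of [M] separates the target from [M]. *)
have [c [Mc tc]] : exists c : 'cV_#|T|, M *m c = 0 /\ vec t *m c != 0.
  move: tM; rewrite submxE => /eqP H; apply: contrapT => /forallNP Hc; apply: H.
  apply/matrixP => i j; apply: contrapT => ne; apply: (Hc (col j (cokermx M))).
  rewrite colE mulmxA mulmx_coker mul0mx mulmxA -colE; split=> //.
  by apply/eqP => /matrixP/(_ i 0); rewrite mxE [RHS]mxE => E0; apply: ne; rewrite E0 mxE.
(* If [c] killed the values of all tuples in the kernels of [phi] and [psi], it would kill the
   target by [target_annihilated]. *)
have [eta [eta1 eta2 etac]] : exists eta, [/\ forall a, ann phi (eta a),
    forall a, ann psi (eta a) & vec (values eta) *m c != 0].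
  apply: contrapT => Hn; case/negP: tc; apply/eqP; rewrite vec_mul.
  rewrite (@target_annihilated _ (sum_fam phi psi)) ?raddf0 //.
    by rewrite card_sum (leq_trans _ leD) // leq_add2l (leq_trans leE') //
      leq_mul2r leqnSn orbT.
  move=> xi Hxi; apply: contrapT => ne; apply: Hn; exists xi; split.
  - by move=> a; have /ann_sum[] := Hxi a.
  - by move=> a; have /ann_sum[] := Hxi a.
  rewrite vec_mul; apply/eqP => /matrixP/(_ 0 0); by rewrite !mxE eqxx mulr1n.
(* Orthogonality to [eta] under every form costs [#|I| * N] further equations. *)
pose psi' := sum_fam psi (fun ia : I * 'I_N => row_of (B ia.1) (eta ia.2)).
exists (E' + I * 'I_N)%type, psi', (M + vec (values eta))%MS; split.
- by rewrite card_sum card_orth mulSn addnC leq_add2l.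
- left; apply: leq_ltn_trans rkM _.
  have lt : (M < M + vec (values eta))%MS.
    rewrite ltmxE addsmxSl /=; apply: contra etac => /(submx_trans (addsmxSr _ _)).
    by move=> /submxP[w ->]; rewrite -mulmxA Mc mulmx0.
  by rewrite ltmxErank in lt; case/andP: lt.
move=> u /sub_addsmxP[[w1 w2] /= ->].
have [xi [xi1 xi2 xi3]] := HU _ (submxMl w1 M).
(* Scaling [eta] by a square root multiplies its values by the wanted coefficient; the cross terms
   vanish by orthogonality. *)
have [s Hs] := sqrtF (w2 0 0).
exists (fun a => xi a + s *: eta a); split.
- by move=> a; apply: ann_lin.
- rewrite -xi2 [w2]mx11_scalar mul_scalar_mx -Hs; apply/rowP => j; rewrite !mxE.
  rewrite /values form_lin2 (form_symB _ (eta _) (xi _)) !(xi3 _ _ _ (eta2 _)).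
  by rewrite mulr0 addr0 mulr0 addr0.
move=> i a p /ann_sum[Hp1 Hp2].
rewrite form_tr formE linearD linearZ /= -!formE -!(form_tr (B i)) xi3 //.
by rewrite add0r formE (Hp2 (i, a)) mulr0.
Qed.

Lemma values_surjective (E : finType) (phi : E -> nat -> F)
    (t : I -> 'I_N -> 'I_N -> F) :
  (forall i a b, t i a b = (-1) ^+ eps i * t i b a) ->
  (#|E| + (#|I| * N * N).+1 * (#|I| * N) <= D)%N ->
  exists xi : 'I_N -> {poly F}, (forall a, ann phi (xi a)) /\
    forall i a b, form (B i) (xi a) (xi b) = t i a b.
Proof.
move=> symt leD; pose t' (x : T) := t x.1.1 x.1.2 x.2.
(* The rank cannot exceed [#|I| * N * N], so with one more round the target is reached. *)
have [//||E' [psi [M [_ HM HU]]]] := @enlarge E phi t' (#|I| * N * N).+1; first exact: leD.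
case: HM => [|/HU[xi [xi1 xi2 _]]].
  rewrite leqNgt ltnS (leq_trans (rank_leq_row _)) //.
  by rewrite !card_prod !card_ord.
exists xi; split=> // i a b.
move/rowP: xi2 => /(_ (enum_rank ((i, a, b) : T))).
by rewrite !mxE enum_rankK.
Qed.

End Values.

(** Duality gives a tuple [eta] with the right values on the [v j]; its Gram matrices are then
    corrected by a tuple [xi] killed by the [v j] and orthogonal to [eta]. *)
Lemma prescribed_values (J : finType) (v : J -> nat -> F) N
    (t : I -> 'I_N -> 'I_N -> F) (w : J -> 'I_N -> F) :
  nondegenerate (#|J| + #|I| * N + (#|I| * N * N).+1 * (#|I| * N)) ->
  (forall w : J -> F, exists p, forall j, lf (v j) p = w j) ->
  (forall i a b, t i a b = (-1) ^+ eps i * t i b a) ->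
  exists zeta : 'I_N -> {poly F},
    (forall i a b, form (B i) (zeta a) (zeta b) = t i a b) /\
    (forall j a, lf (v j) (zeta a) = w j a).
Proof.
move=> ND /(_ (fun j => w j _))-Hv symt.
have [eta Heta] := choice (fun a => Hv a).
have [|| xi [xi1 xi2]] := @values_surjective N _ ND _
  (sum_fam v (fun ia : I * 'I_N => row_of (B ia.1) (eta ia.2)))
  (fun i a b => t i a b - form (B i) (eta a) (eta b)).
- by move=> i a b; rewrite (symt i a b) (form_symB i (eta a)) mulrBr.
- by rewrite card_sum card_orth.
exists (fun a => eta a + 1 *: xi a); split=> [i a b|j a]; last first.
  rewrite linearD linearZ /= Heta.
  by have /ann_sum[/(_ j)->] := xi1 a; rewrite mulr0 addr0.
have orth c d : form (B i) (eta c) (xi d) = 0.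
  by rewrite formE; have /ann_sum[_ /(_ (i, c))] := xi1 d.
rewrite form_lin2 orth (form_symB i (xi a)) orth xi2 !(mul1r, mulr0, addr0).
by rewrite addrC subrK.
Qed.

End Nondegenerate.

(** * Closed stable sets *)

Section Spaces.
Variable F : fieldType.

(** Symmetric and skew matrices form one family over [I], told apart by a sign [eps], so that both
    are treated at once. *)
Definition point (I J K : Type) : Type :=
  ((I -> nat -> nat -> F) * (J -> nat -> F) * (K -> F))%type.

Inductive coord (I J K : Type) (N : nat) : (point I J K -> F) -> Prop :=
| Coord_form i a b of (a < N)%N & (b < N)%N : coord N (fun x => x.1.1 i a b)
| Coord_vec j a of (a < N)%N : coord N (fun x => x.1.2 j a)
| Coord_scal k : coord N (fun x => x.2 k).

Definition polynomial_fun (I J K : Type) :=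
  polyfun (fun g : point I J K -> F => exists N, coord N g).

Section Coordinates.
Variables I J K : Type.
Implicit Type x : point I J K.

Lemma polynomial_form i a b : polynomial_fun (fun x => x.1.1 i a b).
Proof.
apply: Pf_gen; exists (maxn a b).+1.
by apply: Coord_form; rewrite ltnS ?leq_maxl ?leq_maxr.
Qed.

Lemma polynomial_vec j a : polynomial_fun (fun x => x.1.2 j a).
Proof. by apply: Pf_gen; exists a.+1; apply: Coord_vec. Qed.

Lemma polynomial_scal k : polynomial_fun (fun x => x.2 k).
Proof. by apply: Pf_gen; exists 0; apply: Coord_scal. Qed.

Lemma polynomial_finite (f : point I J K -> F) :
  polynomial_fun f -> exists N, polyfun (@coord I J K N) f.
Proof.
apply: polyfun_directed => m n g le [i a b am bm|j a am|k].
- by apply: Coord_form; apply: leq_trans le.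
- by apply: Coord_vec; apply: leq_trans le.
- exact: Coord_scal.
Qed.

Lemma polynomial_comp I' J' K' (phi : point I' J' K' -> point I J K) f :
  (forall i a b, polynomial_fun (fun y => (phi y).1.1 i a b)) ->
  (forall j a, polynomial_fun (fun y => (phi y).1.2 j a)) ->
  (forall k, polynomial_fun (fun y => (phi y).2 k)) ->
  polynomial_fun f -> polynomial_fun (f \o phi).
Proof.
move=> H1 H2 H3; apply: polyfun_comp => _ [N [i a b _ _|j a _|k]].
- exact: H1.
- exact: H2.
- exact: H3.
Qed.

(** [rho a] is row [a] of the acting matrix [g], so entry [(a, b)] of [g M g^T] is the form [M] at
    two rows. Arbitrary rows are allowed, which covers limits of group elements. *)
Definition act (rho : nat -> {poly F}) x : point I J K :=
  (fun i a b => form (x.1.1 i) (rho a) (rho b), fun j a => lf (x.1.2 j) (rho a), x.2).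

Definition graded_sym (eps : I -> bool) x :=
  forall i a b, x.1.1 i a b = (-1) ^+ eps i * x.1.1 i b a.

Lemma graded_sym_act eps rho x : graded_sym eps x -> graded_sym eps (act rho x).
Proof. by move=> H i a b /=; apply: form_sym => c d; apply: H. Qed.

Definition zariski_closed eps (Z : point I J K -> Prop) :=
  exists P : (point I J K -> F) -> Prop, (forall f, P f -> polynomial_fun f) /\
    forall x, Z x <-> graded_sym eps x /\ forall f, P f -> f x = 0.

Variable Gamma : (nat -> {poly F}) -> Prop.

Definition stable (Z : point I J K -> Prop) :=
  forall rho, Gamma rho -> forall x, Z x -> Z (act rho x).

Definition stable_chain eps (Z : nat -> point I J K -> Prop) :=
  (forall t, zariski_closed eps (Z t) /\ stable (Z t)) /\
  (forall t x, Z t.+1 x -> Z t x).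

Definition noetherian eps := forall Z, stable_chain eps Z ->
  exists T, forall t x, (T <= t)%N -> Z T x -> Z t x.

Lemma chain_le eps Z t u x : stable_chain eps Z -> (t <= u)%N -> Z u x -> Z t x.
Proof.
move=> [_ desc] /subnK <-; elim: (u - t)%N => [|k IH] //.
by rewrite addSn => /desc.
Qed.

End Coordinates.

(* [Gamma] stands for the set of row families of the elements of the group: any
   finite family of rows is a limit of initial segments of members of [Gamma]. *)
Definition dense_rows (Gamma : (nat -> {poly F}) -> Prop) :=
  forall N (zeta : 'I_N -> {poly F}), exists eta : 'I_N -> {poly F},
    forall s : F, s != 0 -> exists rho, Gamma rho /\
      forall a : 'I_N, rho a = zeta a + s *: eta a.

Definition ext (T : choiceType) (p : pred T) A (z : A) (f : {x : T | p x} -> A) x :=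
  if insub x is Some y then f y else z.

Lemma ext_val (T : choiceType) (p : pred T) A (z : A) (f : T -> A) x :
  p x -> ext z (fun y : {x : T | p x} => f (val y)) x = f x.
Proof. by move=> px; rewrite /ext insubT. Qed.

Variable Gamma : (nat -> {poly F}) -> Prop.
Hypothesis dense : dense_rows Gamma.
Hypothesis sqrtF : forall a : F, exists b, b * b = a.
Hypothesis char0 : forall n, n.+1%:R != 0 :> F.

(** Along a line of row families starting at [zeta], [f] is a polynomial in [s] that vanishes for
    nonzero [s], where the first [N] rows are those of a group element; hence it vanishes at
    [s = 0]. *)
Lemma stable_limit (I J K : Type) (Z : point I J K -> Prop) N f x
    (zeta : 'I_N -> {poly F}) (y : point I J K) :
  stable Gamma Z -> polyfun (@coord I J K N) f -> (forall z, Z z -> f z = 0) ->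
  Z x ->
  (forall i (a b : 'I_N), y.1.1 i a b = form (x.1.1 i) (zeta a) (zeta b)) ->
  (forall j (a : 'I_N), y.1.2 j a = lf (x.1.2 j) (zeta a)) ->
  (forall k, y.2 k = x.2 k) ->
  f y = 0.
Proof.
move=> stZ polf fZ Zx y1 y2 y3; have [eta Heta] := dense zeta.
pose zt a := @ext nat (fun a => a < N)%N _ 0 (fun y => zeta (Ordinal (valP y))) a.
pose et a := @ext nat (fun a => a < N)%N _ 0 (fun y => eta (Ordinal (valP y))) a.
have ztE a (h : (a < N)%N) : zt a = zeta (Ordinal h).
  by rewrite /zt /ext insubT; congr zeta; apply: val_inj.
have etE a (h : (a < N)%N) : et a = eta (Ordinal h).
  by rewrite /et /ext insubT; congr eta; apply: val_inj.
pose curve s := act (fun a => zt a + s *: et a) x.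
have -> : f y = f (curve 0).
  apply: polyfun_eq polf => _ [i a b am bm|j a am|k] /=.
  - by rewrite !scale0r !addr0 !ztE -y1.
  - by rewrite !scale0r !addr0 !ztE -y2.
  - exact: y3.
apply: (polyfun_line_eq0 (h := f \o curve) char0).
  have pid : polyfun (fun g : F -> F => g = id) id by apply: Pf_gen.
  apply: polyfun_comp polf => _ [i a b _ _|j a _|k] /=.
  - rewrite (_ : _ \o _ = fun s => form (x.1.1 i) (zt a) (zt b) +
        s * (form (x.1.1 i) (zt a) (et b) + form (x.1.1 i) (et a) (zt b)) +
        s * s * form (x.1.1 i) (et a) (et b)); last first.
      by apply/funext => s; rewrite /= form_lin2.
    do ![apply: Pf_add | apply: Pf_mul | exact: pid | exact: Pf_cst].
  - rewrite (_ : _ \o _ = fun s => lf (x.1.2 j) (zt a) + s * lf (x.1.2 j) (et a)); last first.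
      by apply/funext => s; rewrite /= linearD linearZ.
    do ![apply: Pf_add | apply: Pf_mul | exact: pid | exact: Pf_cst].
  - exact: Pf_cst.
move=> s /Heta[rho [Grho rhoE]] /=.
rewrite -(fZ _ (stZ _ Grho _ Zx)).
apply: polyfun_eq polf => _ [i a b am bm|j a am|k] //=.
  by rewrite !ztE !etE -!rhoE.
by rewrite !ztE !etE -!rhoE.
Qed.

(** An equivariant polynomial map pulls a stable closed chain back to another one, which stabilises
    in the source. *)
Lemma noetherian_pullback (I J K I' J' K' : Type) eps eps'
    (phi : point I' J' K' -> point I J K) (Z : nat -> point I J K -> Prop) :
  (forall i a b, polynomial_fun (fun y => (phi y).1.1 i a b)) ->
  (forall j a, polynomial_fun (fun y => (phi y).1.2 j a)) ->
  (forall k, polynomial_fun (fun y => (phi y).2 k)) ->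
  (forall y, graded_sym eps' y -> graded_sym eps (phi y)) ->
  (forall rho y, phi (act rho y) = act rho (phi y)) ->
  noetherian J' K' Gamma eps' -> stable_chain Gamma eps Z ->
  exists T, forall t y, (T <= t)%N -> graded_sym eps' y -> Z T (phi y) -> Z t (phi y).
Proof.
move=> H1 H2 H3 Hsym Hact noeth' [Zst desc].
have [|T HT] := noeth' (fun t y => graded_sym eps' y /\ Z t (phi y)).
  split=> [t|t y [sy /desc]] //.
  have [[P [polP HP]] stZ] := Zst t; split.
    exists (fun g => exists2 f, P f & g = f \o phi); split.
      by move=> _ [f /polP pf ->]; apply: polynomial_comp.
    move=> y; split=> [[sy /HP[_ Hf]]|[sy Hf]].
      by split=> // _ [f Pf ->]; apply: Hf.
    by split=> //; apply/HP; split=> [|f Pf]; [apply: Hsym|apply: (Hf (f \o phi)); exists f].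
  move=> rho Gr y [sy Zy]; split; first exact: graded_sym_act.
  by rewrite Hact; apply: stZ.
by exists T => t y Tt sy Zy; have [] := HT t y Tt (conj sy Zy).
Qed.

(** * Elimination of one matrix *)

Section EliminateForm.
Variables (I J K : finType) (eps : I -> bool) (D : nat) (k : I).
Let I' : finType := {i : I | i != k}.
Let J' : finType := (J + ('I_D + 'I_D))%type.
Let K' : finType := (K + I)%type.

Definition mat0 : nat -> nat -> F := fun _ _ => 0.

Definition restr_sign (i : {i : I | i != k}) := eps (val i).

(** The new scalars are coefficients of the other matrices of the same sign; the [D] pairs of new
    vectors supply the rank-one terms of a form that vanishes in codimension at most [D]. *)
Definition insert_form (y : point {i : I | i != k} (J + ('I_D + 'I_D)) (K + I)) :
    point I J K :=
  (fun i => if i == k then fun a b =>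
       \sum_(l | (eps l == eps k) && (l != k)) y.2 (inr l) * ext mat0 y.1.1 l a b +
       (\sum_e y.1.2 (inr (inl e)) a * y.1.2 (inr (inr e)) b +
        (-1) ^+ eps k * \sum_e y.1.2 (inr (inr e)) a * y.1.2 (inr (inl e)) b)
     else ext mat0 y.1.1 i,
   fun j => y.1.2 (inl j), fun c => y.2 (inl c)).

Let poly_ext i a b :
  polynomial_fun (fun y : point I' J' K' => ext mat0 y.1.1 i a b).
Proof.
rewrite /ext; case: insub => [l|]; last exact: Pf_cst.
exact: polynomial_form.
Qed.

Let ext_sym (y : point I' J' K') i a b : graded_sym restr_sign y ->
  ext mat0 y.1.1 i a b = (-1) ^+ eps i * ext mat0 y.1.1 i b a.
Proof.
move=> sy; rewrite /ext; case: insubP => [l _ <-|_]; last by rewrite mulr0.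
exact: sy.
Qed.

Lemma form0 p q : form mat0 p q = 0.
Proof. by rewrite /form; under eq_fun do rewrite lf0; rewrite lf0. Qed.

Let ext_act rho (y : point I' J' K') i a b :
  ext mat0 (act rho y).1.1 i a b = form (ext mat0 y.1.1 i) (rho a) (rho b).
Proof. by rewrite /ext; case: insub => [l|] //; rewrite form0. Qed.

Lemma insert_form_noetherian (Z : nat -> point I J K -> Prop) :
  noetherian J' K' Gamma restr_sign -> stable_chain Gamma eps Z ->
  exists T, forall t y, (T <= t)%N -> graded_sym restr_sign y ->
    Z T (insert_form y) -> Z t (insert_form y).
Proof.
apply: noetherian_pullback => [i a b|j a|c|y sy i a b|rho y] /=.
- case: eqP => _; last exact: poly_ext.
  do ![apply: Pf_add | apply: Pf_mul | exact: Pf_cst | apply: polyfun_sum => ?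
    | exact: polynomial_scal | exact: polynomial_vec | exact: poly_ext].
- exact: polynomial_vec.
- exact: polynomial_scal.
- case: eqP => [->|_]; last exact: ext_sym.
  set s := (-1) ^+ eps k.
  rewrite !mulrDr; congr (_ + _).
    rewrite mulr_sumr; apply: eq_bigr => l /andP[/eqP el _].
    by rewrite (ext_sym _ _ _ sy) el; rewrite mulrCA.
  rewrite mulrA -expr2 sqrr_sign mul1r addrC; congr (_ + _).
    by congr (_ * _); apply: eq_bigr => e _; rewrite mulrC.
  by apply: eq_bigr => e _; rewrite mulrC.
congr (_, _, _); apply/funext => i; apply/funext => a; apply/funext => b.
case E: (i == k); rewrite /insert_form /= E; last exact: ext_act.
rewrite !formD form_comb formZ !form_sum_rank1; congr (_ + _).
by apply: eq_bigr => l _; rewrite -ext_act.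
Qed.

End EliminateForm.

(** The part [M] of a degenerate combination with the sign of [k] still vanishes on the subspace, so
    it splits into rank-one pairs; dividing by [c k] solves for matrix [k]. *)
Lemma degenerate_insert_form (I J K : finType) (eps : I -> bool) D (x : point I J K) :
  graded_sym eps x -> ~ nondegenerate x.1.1 D ->
  exists k y, graded_sym (restr_sign eps (k := k)) y /\ insert_form eps (D := D) y = x.
Proof.
move=> sx /existsNP[phi /existsNP[c /not_implyP[van /existsNP[k /eqP ck]]]].
pose s : F := (-1) ^+ eps k.
have ss : s * s = 1 by rewrite -expr2 sqrr_sign.
pose M a b := \sum_(i | eps i == eps k) c i * x.1.1 i a b.
have n2 : 2%:R != 0 :> F by apply: char0.
have symM a b : M a b = s * M b a.
  rewrite mulr_sumr; apply: eq_bigr => i /eqP ei.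
  by rewrite sx ei mulrCA.
have vanM p q : ann phi p -> ann phi q -> form M p q = 0.
  move=> Hp Hq; apply: (mulfI n2); rewrite mulr0 /M form_comb.
  (* Adding [s] times the relation with [p] and [q] swapped doubles the terms of the sign of [k] and
     cancels the others. *)
  transitivity (\sum_i c i * form (x.1.1 i) p q + s * \sum_i c i * form (x.1.1 i) q p); last first.
    by rewrite !van // mulr0 addr0.
  rewrite !mulr_sumr -big_split big_mkcond /=; apply: eq_bigr => i _.
  rewrite (form_sym q p (sx i)) /s.
  by case: (eps i); case: (eps k) => /=; ring.
have [f Hf] := vanishing_form_decomposition n2 ss symM vanM.
exists k, (fun i' => x.1.1 (val i'), fun j => match j with
   | inl j => x.1.2 j | inr (inl e) => fun a => (c k)^-1 * phi e a
   | inr (inr e) => f e end, fun z => match z with inl z => x.2 z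
   | inr i => - (c i / c k) end).
split; first by move=> i a b; apply: sx.
case: x => [[B v] w] /= in sx van M symM vanM Hf *.
rewrite /insert_form; congr (_, _, _); apply/funext => i; case: eqP => [->|/eqP ik].
  apply/funext => a; apply/funext => b /=; apply: (mulfI ck).
  have := Hf a b; rewrite {1}/M (bigD1 k) //= => /(canRL (addrK _)) ->.
  rewrite mulrDr addrC mulrDr; congr (_ + _ + _).
  - by rewrite mulr_sumr; apply: eq_bigr => e _; rewrite !mulrA mulfV // mul1r.
  - rewrite mulrCA; congr (_ * _); rewrite mulr_sumr; apply: eq_bigr => e _.
    by rewrite mulrCA mulVKf.
  rewrite mulr_sumr -sumrN; apply: eq_bigr => l /andP[_ lk].
  by rewrite ext_val // mulrA mulrN mulrCA mulfV // mulr1 mulNr.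
by rewrite ext_val.
Qed.

End Spaces.

(** * The double induction *)

Section Induction.
Variable F : fieldType.
Variable Gamma : (nat -> {poly F}) -> Prop.
Hypothesis dense : dense_rows Gamma.
Hypothesis sqrtF : forall a : F, exists b, b * b = a.
Hypothesis char0 : forall n, n.+1%:R != 0 :> F.
Local Notation point := (point F).

(** * Elimination of one vector *)

Section EliminateVector.
Variables (I J K : finType) (eps : I -> bool) (k : J).
Let J' : finType := {j : J | j != k}.
Let K' : finType := (K + J)%type.

Definition vec0 : nat -> F := fun _ => 0.

Definition insert_vec (y : point I {j : J | j != k} (K + J)) : point I J K :=
  (y.1.1,
   fun j => if j == k then fun a => \sum_(l | l != k) y.2 (inr l) * ext vec0 y.1.2 l a
     else ext vec0 y.1.2 j,
   fun c => y.2 (inl c)).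

Let poly_ext j a :
  polynomial_fun (fun y : point I J' K' => ext vec0 y.1.2 j a).
Proof.
rewrite /ext; case: insub => [l|]; last exact: Pf_cst.
exact: polynomial_vec.
Qed.

Let ext_act rho (y : point I J' K') j a :
  ext vec0 (act rho y).1.2 j a = lf (ext vec0 y.1.2 j) (rho a).
Proof. by rewrite /ext; case: insub => [l|] //; rewrite lf0. Qed.

Lemma insert_vec_noetherian (Z : nat -> point I J K -> Prop) :
  noetherian J' K' Gamma eps -> stable_chain Gamma eps Z ->
  exists T, forall t y, (T <= t)%N -> graded_sym eps y ->
    Z T (insert_vec y) -> Z t (insert_vec y).
Proof.
apply: noetherian_pullback => [i a b|j a|c|y sy i a b|rho y] /=.
- exact: polynomial_form.
- case: eqP => _; last exact: poly_ext.
  do ![apply: Pf_mul | apply: polyfun_sum => ? | exact: polynomial_scal | exact: poly_ext].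
- exact: polynomial_scal.
- exact: sy.
congr (_, _, _); apply/funext => j; apply/funext => a.
case E: (j == k); rewrite /insert_vec /= E; last exact: ext_act.
by rewrite lf_comb; apply: eq_bigr => l _; rewrite -ext_act.
Qed.

Lemma dependent_insert_vec (x : point I J K) (c : J -> F) :
  graded_sym eps x -> (forall a, x.1.2 k a = \sum_(j | j != k) c j * x.1.2 j a) ->
  exists2 y, graded_sym eps y & insert_vec y = x.
Proof.
case: x => [[B v] w] /= sx Hc.
exists (B, fun j' => v (val j'), fun z => match z with inl z => w z | inr j => c j end).
  exact: sx.
rewrite /insert_vec; congr (_, _, _); apply/funext => j; case: eqP => [->|/eqP jk].
  by apply/funext => a; rewrite Hc; apply: eq_bigr => l lk; rewrite ext_val.
by rewrite ext_val.
Qed.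

End EliminateVector.

Lemma prescribed_point (I J K : finType) (eps : I -> bool) N f (Z : point I J K -> Prop) x y :
  stable Gamma Z -> polyfun (@coord F I J K N) f -> (forall z, Z z -> f z = 0) ->
  Z x -> graded_sym eps x -> graded_sym eps y -> y.2 = x.2 ->
  nondegenerate x.1.1 (#|J| + #|I| * N + (#|I| * N * N).+1 * (#|I| * N)) ->
  (forall w : J -> F, exists p, forall j, lf (x.1.2 j) p = w j) ->
  f y = 0.
Proof.
move=> stZ polf fZ Zx sx sy y2 ND dual.
have [|zeta [H1 H2]] := prescribed_values sqrtF (char0 1) sx (N := N)
  (t := fun i a b => y.1.1 i a b) (fun j a => y.1.2 j a) ND dual.
  by move=> i a b; apply: sy.
by apply: (stable_limit dense char0 stZ polf fZ Zx (zeta := zeta)) => // k; rewrite y2.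
Qed.

(** Removing a matrix creates new vectors and scalars, removing a vector creates only scalars; the
    hypotheses are quantified accordingly. *)
Lemma noetherian_step (I J K : finType) (eps : I -> bool) :
  (forall (k : I) (J' K' : finType), noetherian J' K' Gamma (restr_sign eps (k := k))) ->
  (forall (k : J) (K' : finType), noetherian {j : J | j != k} K' Gamma eps) ->
  noetherian J K Gamma eps.
Proof.
move=> HI HJ Z chZ; have [cstZ desc] := chZ.
pose slice (y : point I J K) (c : K -> F) : point I J K := (y.1, c).
have polslice y f : polynomial_fun f ->
    polyfun (fun h => exists k, h = fun c : K -> F => c k) (f \o slice y).
  apply: polyfun_comp => _ [N [i a b _ _|j a _|k]].
  - exact: (Pf_cst _ (y.1.1 i a b)).
  - exact: (Pf_cst _ (y.1.2 j a)).
  - by apply: Pf_gen; exists k.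
(* The scalars whose whole fibre lies in [Z t]: a closed set in a finite-dimensional space. *)
pose W t c := forall y, graded_sym eps y -> Z t (slice y c).
have [t|t c Wc y sy|t0 Ht0] := @affine_noetherian F (K -> F) K (fun k c => c k) W.
- have [[P [polP HP]] _] := cstZ t.
  exists (fun h => exists y f, [/\ graded_sym eps y, P f & h = f \o slice y]).
  split=> [_ [y [f [_ /polP polf ->]]]|c]; first exact: polslice.
  split=> [Wc _ [y [f [sy Pf ->]]]|H y sy].
    by have /HP[_] := Wc y sy; apply.
  by apply/HP; split=> // f Pf; apply: (H (f \o slice y)); exists y, f.
- by apply: desc; apply: Wc.
have [[P [polP HP]] stZ] := cstZ t0.
(* Only equations in coordinates below [N] are imposed; these sets descend with [N], and a
   stationary one equals [W t0]. *)
pose W' N c := forall y f, graded_sym eps y -> P f -> polyfun (@coord F I J K N) f ->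
  f (slice y c) = 0.
have [N|N c Wc y f sy Pf polf|N HN] := @affine_noetherian F (K -> F) K (fun k c => c k) W'.
- exists (fun h => exists y f, [/\ graded_sym eps y, P f,
     polyfun (@coord F I J K N) f & h = f \o slice y]).
  split=> [_ [y [f [_ /polP polf _ ->]]]|c]; first exact: polslice.
  split=> [Wc _ [y [f [sy Pf polf ->]]]|H y f sy Pf polf]; first exact: Wc.
  by apply: (H (f \o slice y)); exists y, f.
- apply: Wc => //; apply: polyfun_sub polf => g [i a b am bm|j a am|k].
  + by apply: Coord_form; apply: leqW.
  + by apply: Coord_vec; apply: leqW.
  + exact: Coord_scal.
pose D := (#|J| + #|I| * N + (#|I| * N * N).+1 * (#|I| * N))%N.
(* [D] does not depend on [x], so finitely many insertion maps cover the points outside the full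
   fibres. *)
have cover x : Z t0 x -> W t0 x.2 \/
    ((exists k y, graded_sym (restr_sign eps (k := k)) y /\ insert_form eps (D := D) y = x) \/
     (exists k (y : point I {j : J | j != k} (K + J)), graded_sym eps y /\ insert_vec y = x)).
  move=> Zx; have /HP[sx _] := Zx.
  have [ND|] := EM (nondegenerate x.1.1 D); last first.
    by move=> /(degenerate_insert_form char0 sx); right; left.
  have [dual|[k [c Hc]]] := dual_or_dependent x.1.2; last first.
    by right; right; have [y sy <-] := dependent_insert_vec sx Hc; exists k, y.
  left; suff W'N : W' N x.2.
    move=> y sy; apply/HP; split=> // f Pf.
    have [M polf] := polynomial_finite (polP f Pf).
    have [MN|/ltnW NM] := leqP M N; last exact: (HN M).
    apply: W'N => //; apply: polyfun_sub polf => g [i a b am bm|j a am|k].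
    + by apply: Coord_form; apply: leq_trans MN.
    + by apply: Coord_vec; apply: leq_trans MN.
    + exact: Coord_scal.
  move=> y f sy Pf polf.
  by apply: (prescribed_point stZ polf _ Zx sx _ _ ND dual) => // z /HP[_]; apply.
have [||T1 HT1] := @finite_threshold I (fun k T => forall t y, (T <= t)%N ->
    graded_sym (restr_sign eps (k := k)) y ->
    Z T (insert_form eps (D := D) y) -> Z t (insert_form eps (D := D) y)).
- move=> k T u Tu HT t y ut sy Zy; apply: HT => //; first exact: leq_trans ut.
  exact: chain_le chZ Tu Zy.
- by move=> k; apply: insert_form_noetherian chZ; apply: HI.
have [||T2 HT2] := @finite_threshold J (fun k T => forall t
    (y : point I {j : J | j != k} (K + J)), (T <= t)%N -> graded_sym eps y ->
    Z T (insert_vec y) -> Z t (insert_vec y)).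
- move=> k T u Tu HT t y ut sy Zy; apply: HT => //; first exact: leq_trans ut.
  exact: chain_le chZ Tu Zy.
- by move=> k; apply: insert_vec_noetherian chZ; apply: HJ.
exists (maxn t0 (maxn T1 T2)) => t x; rewrite !geq_max => /and3P[t0t T1t T2t] ZT.
have Zu u : (u <= maxn t0 (maxn T1 T2))%N -> Z u x.
  by move=> le; apply: chain_le chZ le ZT.
have /cover[Wx|[[k [y [sy xE]]]|[k [y [sy xE]]]]] := Zu t0 (leq_maxl _ _).
- have := Ht0 t x.2 t0t Wx x; rewrite /slice -surjective_pairing; apply.
  by have /HP[] := Zu t0 (leq_maxl _ _).
- rewrite -xE; apply: (HT1 k) => //; rewrite xE; apply: Zu.
  by rewrite !leq_max leqnn !orbT.
- rewrite -xE; apply: (HT2 k) => //; rewrite xE; apply: Zu.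
  by rewrite !leq_max leqnn !orbT.
Qed.

Lemma card_delete (T : finType) (k : T) : (#|{: {x : T | x != k}}| < #|T|)%N.
Proof.
rewrite card_sig [X in (_ < X)%N](cardD1 k T) inE add1n ltnS.
by apply/subset_leq_card/subsetP => x; rewrite !inE andbT.
Qed.

(** Lexicographic induction on the numbers of matrices and vectors, since removing a matrix may add
    vectors. *)
Theorem all_noetherian (I J K : finType) (eps : I -> bool) : noetherian J K Gamma eps.
Proof.
have [n] := ubnP #|I|; elim: n I J K eps => // n IHn I J K eps ltIn.
have [m] := ubnP #|J|; elim: m J K => // m IHm J K ltJm.
apply: noetherian_step => [k J' K'|k K'].
  by apply: IHn; apply: leq_trans (card_delete k) _.
by apply: IHm; apply: leq_trans (card_delete k) _.
Qed.

End Induction.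

(** * The group of finitary invertible matrices *)

Section Completion.
Variables (F : fieldType) (N L : nat) (z : nat -> {poly F}) (s : F).
Hypothesis leNL : (N <= L)%N.
Hypothesis size_z : forall a, (a < N)%N -> (size (z a) <= L)%N.
Hypothesis sn0 : s != 0.

(** For [N <= L] this is the involution exchanging the intervals [[0, N)] and [[L, L + N)]. *)
Definition swap_blocks j :=
  (if j < N then j + L else if (L <= j) && (j < L + N) then j - L else j)%N.

Let swapK j : swap_blocks (swap_blocks j) = j.
Proof. by rewrite /swap_blocks; do !case: ifP; lia. Qed.

(* The rows [z a + s X^(L + a)], [a < N], completed by unit rows: since [z] is
   supported below [L], the coefficient [s] is the only pivot to be inverted. *)
Definition completion i j : F :=
  if (i < N)%N then (z i)`_j + s * (j == (L + i)%N)%:R else (j == swap_blocks i)%:R.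

(** The unit rows of [completion] give the unknowns below [L] directly; row [a < N] is then solved
    for unknown [L + a] by dividing by [s]. *)
Definition completion_inv i j : F :=
  if (L <= i)%N && (i < L + N)%N
  then s^-1 * ((j == (i - L)%N)%:R - (if (N <= j)%N then (z (i - L)%N)`_(swap_blocks j) else 0))
  else (j == swap_blocks i)%:R.

Lemma sum_delta n k (f : nat -> F) : (k < n)%N ->
  \sum_(l < n) (l == k :> nat)%:R * f l = f k.
Proof.
move=> ltkn; rewrite (bigD1 (Ordinal ltkn)) //= eqxx mul1r big1 ?addr0 // => l lk.
by rewrite (_ : (l == k :> nat) = false) ?mul0r //; apply: negbTE.
Qed.

Lemma completion_mulV i j : (i < L + N)%N -> (j < L + N)%N ->
  \sum_(l < L + N) completion i l * completion_inv l j = (i == j)%:R.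
Proof.
move=> iK jK; rewrite /completion; case: ltnP => [iN|Ni]; last first.
  rewrite (sum_delta (fun l => completion_inv l j)); last first.
    by rewrite /swap_blocks; do !case: ifP; lia.
  rewrite /completion_inv ifF; last by rewrite /swap_blocks; do !case: ifP; lia.
  by rewrite swapK eq_sym.
under eq_bigr do rewrite mulrDl -mulrA.
rewrite big_split /= -mulr_sumr (sum_delta (fun l => completion_inv l j)); last by lia.
pose w := if (N <= j)%N then (z i)`_(swap_blocks j) else 0.
have -> : completion_inv (L + i)%N j = s^-1 * ((j == i)%:R - w).
  by rewrite /completion_inv leq_addr ltn_add2l iN addKn.
rewrite mulVKf // (eq_bigr (fun l : 'I_(L + N) => (l == swap_blocks j :> nat)%:R * w)).
  rewrite (sum_delta (fun=> w)); last by rewrite /swap_blocks; do !case: ifP; lia.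
  by rewrite addrC subrK eq_sym.
move=> l _; have [Ll|lL] := leqP L l.
  rewrite (nth_default 0 (leq_trans (size_z iN) Ll)) mul0r /w.
  case: leqP => Nj; last by rewrite mulr0.
  rewrite (_ : (l == _ :> nat) = false) ?mul0r //.
  by apply/negbTE; rewrite /swap_blocks; do !case: ifP; lia.
rewrite /completion_inv leqNgt lL /= mulrC.
have -> : (j == swap_blocks l) = (l == swap_blocks j :> nat).
  by apply/eqP/eqP => ->; rewrite swapK.
case: eqP => [E|_]; last by rewrite !mul0r.
rewrite !mul1r /w E ifT //.
by move: lL; rewrite E /swap_blocks; do !case: ifP; lia.
Qed.

Lemma completion_Vmul i j : (i < L + N)%N -> (j < L + N)%N ->
  \sum_(l < L + N) completion_inv i l * completion l j = (i == j)%:R.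
Proof.
move=> iK jK.
pose A : 'M[F]_(L + N) := \matrix_(i, j) completion i j.
pose A' : 'M[F]_(L + N) := \matrix_(i, j) completion_inv i j.
have : A *m A' = 1%:M.
  apply/matrixP => a b; rewrite !mxE -(completion_mulV (ltn_ord a) (ltn_ord b)).
  by apply: eq_bigr => l _; rewrite !mxE.
move=> /mulmx1C/matrixP/(_ (Ordinal iK) (Ordinal jK)); rewrite !mxE => <-.
by apply: eq_bigr => l _; rewrite !mxE.
Qed.

Lemma completion_outside i j :
  ((L + N <= i) || (L + N <= j))%N -> completion i j = (i == j)%:R.
Proof.
move=> out; rewrite /completion; case: ltnP => [iN|Ni].
  rewrite nth_default; last by apply: leq_trans (size_z iN) _; lia.
  rewrite add0r (_ : (j == _) = false) ?mulr0; last by apply/negbTE; lia.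
  by rewrite (_ : (i == j) = false) //; apply/negbTE; lia.
by congr (nat_of_bool _)%:R; apply/eqP/eqP; rewrite /swap_blocks; do !case: ifP; lia.
Qed.

End Completion.

(** * Transport to the coordinates of the statement *)

Section Transport.

Lemma CmulE (a b : Defs.C) : Cmul a b = a * b. Proof. by []. Qed.

Lemma Csum_big N f : Csum N f = \sum_(i < N) f i.
Proof. by elim: N => [|N IH] /=; rewrite ?big_ord0 // big_ord_recr IH. Qed.

Lemma kronE i j : kron i j = (i == j)%:R.
Proof. by rewrite /kron; case: Nat.eqb_spec => [->|/eqP/negbTE->]; rewrite ?eqxx. Qed.

(** The cut-off is the summation bound of [gact]. *)
Definition group_row K (g : Mat) (a : nat) : {poly Defs.C} :=
  \poly_(b < K + a + 1) g a b.

Definition group_rows (rho : nat -> {poly Defs.C}) :=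
  exists K g, inGL K g /\ rho = group_row K g.

Lemma lf_group_row u K g a :
  lf u (group_row K g a) = Csum (K + a + 1) (fun b => Cmul (g a b) (u b)).
Proof.
rewrite (lfE u (size_poly _ _)) Csum_big; apply: eq_bigr => b _.
by rewrite coef_poly ltn_ord.
Qed.

Lemma form_group_row M K g i j :
  form M (group_row K g i) (group_row K g j) =
  Csum (K + i + 1) (fun a => Csum (K + j + 1) (fun b =>
    Cmul (g i a) (Cmul (M a b) (g j b)))).
Proof.
rewrite /form lf_group_row !Csum_big; apply: eq_bigr => a _.
rewrite lf_group_row !Csum_big CmulE mulr_sumr; apply: eq_bigr => b _.
by congr Cmul; apply: CmulC.
Qed.

Lemma dense_group_rows : dense_rows group_rows.
Proof.
move=> N zeta; pose z a := if insub a is Some k then zeta k else 0.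
have zE (a : 'I_N) : z a = zeta a by rewrite /z valK.
pose L := maxn N (\max_(a < N) size (zeta a)).
have leNL : (N <= L)%N by apply: leq_maxl.
have size_z a : (a < N)%N -> (size (z a) <= L)%N.
  move=> aN; rewrite -[a]/(val (Ordinal aN)) zE leq_max orbC.
  by rewrite (leq_bigmax (Ordinal aN)).
(* The directions are unit vectors beyond the support of every [zeta a], so the perturbed rows are
   independent for nonzero [s]. *)
exists (fun a => 'X^(L + a)) => s sn0.
exists (group_row (L + N) (completion N L z s)); split.
  exists (L + N)%N, (completion N L z s); split=> //; split=> [i j out|].
    rewrite kronE completion_outside //.
    by case: out => /leP ->; rewrite ?orbT.
  exists (completion_inv N L z s); split=> i j /ltP iK /ltP jK.
    by rewrite Csum_big kronE; apply: completion_mulV.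
  by rewrite Csum_big kronE; apply: completion_Vmul.
move=> a; apply/polyP => b; rewrite coef_poly coefD coefZ coefXn /completion ltn_ord zE.
case: ltnP => // le; rewrite nth_default; last first.
  by rewrite -zE (leq_trans (size_z a (ltn_ord a))) //; lia.
by rewrite (_ : (b == _) = false) ?mulr0 ?addr0 //; apply/negbTE; lia.
Qed.

Variables p q n m : nat.
Local Notation forms := ('I_p + 'I_q)%type.
Local Notation pt := (point Defs.C forms 'I_n 'I_m).

Definition alternating (i : forms) := if i is inr _ then true else false.

Definition embed (x : pt) : Point := fun c => match c with
  | cS k i j => if insub k is Some k then x.1.1 (inl k) i j else 0
  | cA k i j => if insub k is Some k then x.1.1 (inr k) i j else 0
  | cV k i => if insub k is Some k then x.1.2 k i else 0
  | cC k => if insub k is Some k then x.2 k else 0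
  end.

Definition restrict (z : Point) : pt :=
  (fun (i : forms) a b => match i with inl k => z (cS k a b) | inr k => z (cA k a b) end,
   fun (j : 'I_n) a => z (cV j a), fun (k : 'I_m) => z (cC k)).

Lemma inT_embed x : graded_sym alternating x -> inT p q n m (embed x).
Proof.
move=> sx; split; [|split; [|split; [|split; [|split]]]].
- move=> k i j /=; case: insub => [l|] //.
  by rewrite (sx (inl l)) expr0 mul1r.
- move=> k i j /=; case: insub => [l|]; last exact/esym/(oppr0 Defs.C).
  by rewrite (sx (inr l)) expr1 mulN1r.
- by move=> k i j /leP le /=; rewrite insubF // ltnNge le.
- by move=> k i j /leP le /=; rewrite insubF // ltnNge le.
- by move=> k i /leP le /=; rewrite insubF // ltnNge le.
- by move=> k /leP le /=; rewrite insubF // ltnNge le.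
Qed.

Lemma restrict_sym z : inT p q n m z -> graded_sym alternating (restrict z).
Proof.
move=> [H1 [H2 _]] [k|k] a b /=; first by rewrite expr0 mul1r.
by rewrite expr1 mulN1r; apply: H2.
Qed.

Lemma restrictK z : inT p q n m z -> embed (restrict z) = z.
Proof.
move=> [_ [_ [H1 [H2 [H3 H4]]]]]; apply/funext => -[k i j|k i j|k i|k] /=;
  case: insubP => [l _ <- //|]; rewrite -leqNgt => /leP le; apply/esym.
- exact: H1.
- exact: H2.
- exact: H3.
- exact: H4.
Qed.

Lemma embed_act K g x : embed (act (group_row K g) x) = gact K g (embed x).
Proof.
apply/funext => -[k i j|k i j|k i|k] //=; case: insub => [l|].
- exact: form_group_row.
- rewrite Csum_big big1 // => a _; rewrite Csum_big big1 // => b _.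
  by rewrite !CmulE mul0r mulr0.
- exact: form_group_row.
- rewrite Csum_big big1 // => a _; rewrite Csum_big big1 // => b _.
  by rewrite !CmulE mul0r mulr0.
- exact: lf_group_row.
- rewrite Csum_big big1 // => a _.
  by rewrite !CmulE mulr0.
Qed.

Lemma polynomial_peval f : polynomial_fun (fun x : pt => peval f (embed x)).
Proof.
elim: f => [c|v|f Hf g Hg|f Hf g Hg].
- exact: Pf_cst.
- case: v => [k i j|k i j|k i|k] /=; case: insub => [l|]; try exact: Pf_cst.
  + exact: polynomial_form.
  + exact: polynomial_form.
  + exact: polynomial_vec.
  + exact: polynomial_scal.
- exact: (Pf_add Hf Hg).
- exact: (Pf_mul Hf Hg).
Qed.

End Transport.

Theorem mainTheorem1 (p q n m : nat) : Ginf_Noetherian p q n m.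
Proof.
case=> Z [clZ strictZ].
pose Z' t (x : point Defs.C ('I_p + 'I_q) 'I_n 'I_m) :=
  graded_sym (@alternating p q) x /\ Z t (embed x).
have [|T HT] := all_noetherian dense_group_rows Csqrt_exists C_char0
    (eps := @alternating p q) (Z := Z').
  split=> [t|t x [sx Zx]]; last by split=> //; have [sub _] := strictZ t; apply: sub.
  have [[P HP] stZ] := clZ t; split.
    exists (fun f => exists2 f', P f' & f = fun x => peval f' (embed x)).
    split=> [_ [f _ ->]|x]; first exact: polynomial_peval.
    split=> [[sx /HP[_ Zx]]|[sx H]]; first by split=> // _ [f Pf ->]; apply: Zx.
    split=> //; apply/HP; split=> [|f Pf]; first exact: inT_embed.
    by apply: (H (fun x => peval f (embed x))); exists f.
  move=> _ [K [g [Kg ->]]] x [sx Zx]; split; first exact: graded_sym_act.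
  by rewrite embed_act; apply: stZ.
(* A point lost between [Z T] and [Z T.+1] contradicts the stabilisation at [T]. *)
have [_ [z [Zz nZz]]] := strictZ T; apply: nZz.
have inTz : inT p q n m z by have [[P HP] _] := clZ T; have /HP[] := Zz.
have ZT : Z' T (restrict p q n m z).
  by split; [apply: restrict_sym|rewrite restrictK].
by have [_] := HT T.+1 _ (leqnSn T) ZT; rewrite restrictK.
Qed.
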